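(* Let $A,B,C$ be pairwise disjoint finite sets and let $\mathcal{M}_{AB},\mathcal{M}_{BC}$ be matroids on $A\uplus B$, $B\uplus C$ respectively. Then: 1. The full sum property of $\{\mathcal{M}_{AB},\mathcal{M}_{BC}\}$ is equivalent to $(\mathcal{M}_{AB}\vee\mathcal{M}_{BC})\circ B=\mathcal{F}_B$, equivalently, to there being bases $b_{AB},b_{BC}$ of $\mathcal{M}_{AB},\mathcal{M}_{BC}$ respectively such that $b_{AB}\cup b_{BC}\supseteq B$. 2. The zero intersection property of $\{\mathcal{M}_{AB},\mathcal{M}_{BC}\}$ is equivalent to $(\mathcal{M}_{AB}\wedge\mathcal{M}_{BC})\times B=\mathbf{0}_B$, equivalently, to there being bases $b_{AB},b_{BC}$ of $\mathcal{M}_{AB},\mathcal{M}_{BC}$ respectively such that $b_{AB}\cap b_{BC}=\emptyset$. 3. The pair $\{\mathcal{M}_{AB},\mathcal{M}_{BC}\}$ is rigid iff $r(\mathcal{M}_{AB}\vee\mathcal{M}_{BC})=r(\mathcal{M}_{AB})+r(\mathcal{M}_{BC})$ and $r(\mathcal{M}_{AB}^*\vee\mathcal{M}_{BC}^* )=r(\mathcal{M}_{AB}^* )+r(\mathcal{M}_{BC}^* )$. 4. The pair $\{\mathcal{M}_{AB},\mathcal{M}_{BC}\}$ has the zero intersection (respectively full sum) property iff $\{\mathcal{M}_{AB}^*,\mathcal{M}_{BC}^*\}$ has the full sum (respectively zero intersection) property. Therefore $\{\mathcal{M}_{AB},\mathcal{M}_{BC}\}$ is rigid iff $\{\mathcal{M}_{AB}^*,\mathcal{M}_{BC}^*\}$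 is rigid. 5. $\{\mathcal{M}_{AB},\mathcal{M}_{BC}\}$ is rigid iff there exist disjoint bases $b_{AB},b_{BC}$ of $\mathcal{M}_{AB},\mathcal{M}_{BC}$ respectively such that $b_{AB}\cup b_{BC}\supseteq B$.
   Context: All matroids are on finite sets; a matroid on $X\uplus Y$ carries the subscript $XY$. $r$ is rank, $\mathcal{M}^*$ the dual. $\mathcal{F}_S$ is the matroid on $S$ with unique base $S$, $\mathbf{0}_S$ the matroid on $S$ with unique base $\emptyset$; $\oplus$ is direct sum; $\mathcal{M}\circ T$ is restriction to $T$, $\mathcal{M}\times T=(\mathcal{M}^*\circ T)^*$ is contraction to $T$. For matroids on the same set, the union $\mathcal{M}_1\vee\mathcal{M}_2$ has as bases the maximal sets of form $b_1\cup b_2$, and $\mathcal{M}_1\wedge\mathcal{M}_2$ has as bases the minimal sets of form $b_1\cap b_2$, $b_i$ a base of $\mathcal{M}_i$. For pairwise disjoint $S,P,Q$: $\mathcal{M}_{SP}\vee\mathcal{M}_{PQ}=(\mathcal{M}_{SP}\oplus\mathbf{0}_Q)\vee(\mathcal{M}_{PQ}\oplus\mathbf{0}_S)$ and $\mathcal{M}_{SP}\wedge\mathcal{M}_{PQ}=(\mathcal{M}_{SP}\oplus\mathcal{F}_Q)\wedge(\mathcal{M}_{PQ}\oplus\mathcal{F}_S)$. The pair $\{\mathcal{M}_{AB},\mathcal{M}_{BC}\}$ has the full sum property iff $\mathcal{M}_{AB}\circ B\vee\mathcal{M}_{BC}\circ B=\mathcal{F}_B$, the zero intersection property iff $\mathcal{M}_{AB}\times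 B\wedge\mathcal{M}_{BC}\times B=\mathbf{0}_B$, and is rigid iff it has both (when $B=\emptyset$ it is taken to be rigid). *)

(* Defs.v *)
From mathcomp Require Import all_boot.

Set Implicit Arguments.
Unset Strict Implicit.
Unset Printing Implicit Defensive.

(* The finite sets carrying the matroids are subsets of an
   ambient finite type T, which plays no other role. *)

Definition base_axiom (T : finType) (E : {set T}) (Bs : {set {set T}}) : bool :=
  [&& Bs != set0,
      [forall b in Bs, b \subset E] &
      [forall b1 in Bs, forall b2 in Bs, forall x in b1 :\: b2,
         exists y in b2 :\: b1, (y |: (b1 :\ x)) \in Bs]].

(* The axiom is boolean, so equality of matroids is equality of ground sets
   and of families of bases (matroid_eq below). *)
Record matroid (T : finType) := Matroid {
  ground : {set T};
  bases : {set {set T}};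
  matroid_axiom : base_axiom ground bases }.

Lemma matroid_eq (T : finType) (M N : matroid T) :
  ground M = ground N -> bases M = bases N -> M = N.
Proof.
case: M N => [E Bs ax] [E' Bs' ax'] /= eE eB.
by move: ax'; rewrite -eE -eB => ax'; rewrite (bool_irrelevance ax ax').
Qed.

Lemma base_axiomP (T : finType) (E : {set T}) (Bs : {set {set T}}) :
  reflect [/\ exists b, b \in Bs,
              forall b, b \in Bs -> b \subset E &
              forall b1 b2 x, b1 \in Bs -> b2 \in Bs -> x \in b1 :\: b2 ->
                exists2 y, y \in b2 :\: b1 & (y |: (b1 :\ x)) \in Bs]
          (base_axiom E Bs).
Proof.
apply: (iffP and3P) => [[/set0Pn nz /forall_inP sE ex]|[nz sE ex]]; split=> //.
- move=> b1 b2 x h1 h2 hx.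
  move/forall_inP: ex => /(_ _ h1)/forall_inP/(_ _ h2)/forall_inP/(_ _ hx).
  by case/exists_inP=> y; exists y.
- exact/set0Pn.
- exact/forall_inP.
- apply/forall_inP=> b1 h1; apply/forall_inP=> b2 h2; apply/forall_inP=> x hx.
  by apply/exists_inP; have [y ? ?] := ex _ _ _ h1 h2 hx; exists y.
Qed.

Definition subfam (T : finType) (Bs : {set {set T}}) : {set {set T}} :=
  [set I : {set T} | [exists b in Bs, I \subset b]].

Definition indep (T : finType) (M : matroid T) : {set {set T}} :=
  subfam (bases M).

Definition rank (T : finType) (M : matroid T) : nat :=
  \max_(b in bases M) #|b|.

Definition maxfam (T : finType) (F : {set {set T}}) : {set {set T}} :=
  [set X | maxset (fun Y => Y \in F) X].

Definition minfam (T : finType) (F : {set {set T}}) : {set {set T}} :=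
  [set X | minset (fun Y => Y \in F) X].

Lemma subfamP (T : finType) (Bs : {set {set T}}) (I : {set T}) :
  reflect (exists2 b, b \in Bs & I \subset b) (I \in subfam Bs).
Proof. by rewrite inE; apply: exists_inP. Qed.

Lemma card_exch (T : finType) (b : {set T}) (x y : T) :
  x \in b -> y \notin b -> #|y |: (b :\ x)| = #|b|.
Proof. by move=> xb yb; rewrite cardsU1 !inE (negPf yb) andbF (cardsD1 x b) xb. Qed.

Lemma base_card (T : finType) (E : {set T}) (Bs : {set {set T}}) :
  base_axiom E Bs -> forall b1 b2, b1 \in Bs -> b2 \in Bs -> #|b1| = #|b2|.
Proof.
case/base_axiomP=> _ _ ex b1 b2; have [n] := ubnP #|b1 :\: b2|.
elim: n b1 => // n IH b1 ltn h1 h2.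
have [d0|[x xD]] := set_0Vmem (b1 :\: b2).
  suff -> : b1 = b2 by [].
  apply/eqP; rewrite eqEsubset -setD_eq0 d0 eqxx /=.
  apply/subsetP=> x x2; apply/negPn/negP=> x1.
  have xD : x \in b2 :\: b1 by rewrite inE x1.
  by have [y] := ex _ _ _ h2 h1 xD; rewrite d0 inE.
have [y yD h3] := ex _ _ _ h1 h2 xD.
move: (xD) (yD); rewrite !inE => /andP[xn2 x1] /andP[yn1 y2].
rewrite -(IH _ _ h3 h2) ?card_exch //.
rewrite -ltnS; apply: leq_trans ltn; rewrite ltnS.
apply: proper_card; apply/properP; split.
  apply/subsetP=> z; rewrite !inE => /andP[zn2].
  case/orP=> [/eqP zy|/andP[_ ->]]; last by rewrite zn2.
  by rewrite zy y2 in zn2.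
exists x => //; rewrite !inE eqxx /= orbF xn2 /=.
by apply/eqP=> xy; rewrite xy y2 in xn2.
Qed.

Lemma base_between (T : finType) (E : {set T}) (Bs : {set {set T}}) :
  base_axiom E Bs -> forall I b1 b2 : {set T}, b1 \in Bs -> b2 \in Bs -> I \subset b1 ->
  exists b, [/\ b \in Bs, I \subset b & b \subset I :|: b2].
Proof.
case/base_axiomP=> _ _ ex I b1 b2; have [n] := ubnP #|b1 :\: (I :|: b2)|.
elim: n b1 => // n IH b1 ltn h1 h2 sI.
have [d0|[x xD]] := set_0Vmem (b1 :\: (I :|: b2)).
  by exists b1; split=> //; rewrite -setD_eq0 d0.
move: (xD); rewrite !inE negb_or => /andP[/andP[xnI xn2] x1].
have xD2 : x \in b1 :\: b2 by rewrite inE xn2.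
have [y yD h3] := ex _ _ _ h1 h2 xD2.
move: (yD); rewrite !inE => /andP[yn1 y2].
apply: (IH _ _ h3 h2).
  rewrite -ltnS; apply: leq_trans ltn; rewrite ltnS.
  apply: proper_card; apply/properP; split.
    apply/subsetP=> z; rewrite !inE => /andP[zn2].
    case/orP=> [/eqP zy|/andP[_ ->]]; last by rewrite zn2.
    by rewrite zy y2 orbT in zn2.
  exists x => //; rewrite !inE eqxx /= orbF negb_and negbK.
  by apply/orP; right; apply/eqP=> xy; rewrite xy y2 in xn2.
apply/subsetP=> z zI; rewrite !inE (subsetP sI _ zI) andbT.
by apply/orP; right; apply/eqP=> zx; rewrite -zx zI in xnI.
Qed.

Definition augment (T : finType) (F : {set {set T}}) : Prop :=
  forall I J : {set T}, I \in subfam F -> J \in subfam F -> #|I| < #|J| ->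
  exists2 x, x \in J :\: I & (x |: I) \in subfam F.

Lemma base_augment (T : finType) (E : {set T}) (Bs : {set {set T}}) :
  base_axiom E Bs -> augment Bs.
Proof.
move=> ax I J /subfamP[b1 h1 sI] /subfamP[b2 h2 sJ] lt.
have [b [hb sIb sb]] := base_between ax h1 h2 sI.
have [d0|[x]] := set_0Vmem (b :&: (J :\: I)); last first.
  rewrite inE => /andP[xb xJ]; exists x => //; apply/subfamP; exists b => //.
  by rewrite subUset sub1set xb.
have sb' : b \subset I :|: (b2 :\: J).
  apply/subsetP=> z zb; have := subsetP sb _ zb; rewrite !inE.
  case zI: (z \in I) => //= ->; rewrite andbT; apply/negP=> zJ.
  by have := in_set0 z; rewrite -d0 !inE zb zI zJ.
have := leq_trans (subset_leq_card sb') (leq_card_setU _ _).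
rewrite (base_card ax hb h2) cardsD (setIidPr sJ).
move=> le; have := subset_leq_card sJ => leJ.
by move: le; rewrite -{1}(subnK leJ) addnC leq_add2r leqNgt lt.
Qed.

Lemma maxfam_axiom (T : finType) (E : {set T}) (F : {set {set T}}) :
  (exists X, X \in F) -> (forall X, X \in F -> X \subset E) -> augment F ->
  base_axiom E (maxfam F).
Proof.
move=> [X0 X0F] sE aug.
have maxE X : X \in F -> exists2 b, b \in maxfam F & X \subset b.
  move=> XF; have [b bm sb] := @maxset_exists _ (fun Y => Y \in F) _ XF.
  by exists b => //; rewrite inE.
have maxF b : b \in maxfam F -> b \in F by rewrite inE; apply: maxsetp.
have mx b X : b \in maxfam F -> X \in F -> b \subset X -> X = b.
  by rewrite inE => /maxsetP[_ h]; apply: h.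
have FS X : X \in F -> X \in subfam F by move=> h; apply/subfamP; exists X.
have le b1 b2 : b1 \in maxfam F -> b2 \in maxfam F -> #|b1| <= #|b2|.
  move=> h1 h2; rewrite leqNgt; apply/negP=> lt.
  have [x] := aug _ _ (FS _ (maxF _ h2)) (FS _ (maxF _ h1)) lt.
  rewrite inE => /andP[xn _] /subfamP[X XF]; rewrite subUset sub1set.
  by case/andP=> xX /(mx _ _ h2 XF) eX; rewrite -eX xX in xn.
apply/base_axiomP; split.
- by have [b ? _] := maxE _ X0F; exists b.
- by move=> b /maxF /sE.
move=> b1 b2 x h1 h2; rewrite inE => /andP[xn2 x1].
have sub1 : b1 :\ x \in subfam F.
  by apply/subfamP; exists b1; rewrite ?maxF ?subD1set.
have lt : #|b1 :\ x| < #|b2|.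
  by apply: leq_trans (le _ _ h1 h2); rewrite [X in _ < X](cardsD1 x) x1.
have [y] := aug _ _ sub1 (FS _ (maxF _ h2)) lt.
rewrite in_setD in_setD1 negb_and negbK => /andP[yn y2] /subfamP[X XF sX].
have yx : y != x by apply: contraNneq xn2 => <-.
have yn1 : y \notin b1 by rewrite (negPf yx) /= in yn.
exists y; first by rewrite inE yn1.
have [b3 h3 sX3] := maxE _ XF; suff -> : y |: (b1 :\ x) = b3 by [].
apply/eqP; rewrite eqEcard (subset_trans sX sX3) card_exch //.
exact: le.
Qed.

Lemma dual_axiom (T : finType) (E : {set T}) (Bs : {set {set T}}) :
  base_axiom E Bs -> base_axiom E [set E :\: b | b in Bs].
Proof.
move=> ax; have [[b0 h0] sE _] := base_axiomP _ _ ax.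
apply/base_axiomP; split.
- by exists (E :\: b0); apply: imset_f.
- by move=> _ /imsetP[b _ ->]; apply: subsetDl.
move=> _ _ x /imsetP[b1 h1 ->] /imsetP[b2 h2 ->].
rewrite !inE negb_and negbK => /andP[+ /andP[xn1 xE]].
rewrite xE orbF => x2.
have sI : x |: (b1 :&: b2) \subset b2 by rewrite subUset sub1set x2 subsetIr.
have [b [hb sb sbU]] := base_between ax h2 h1 sI.
have sbx : b \subset x |: b1.
  by apply: subset_trans sbU _; rewrite subUset setUS ?subsetIl //= subsetUr.
have xb : x \in b by apply: (subsetP sb); rewrite !inE eqxx.
have [y y1 yb] : exists2 y, y \in b1 & y \notin b.
  apply/subsetPn/negP=> s; have sx : x |: b1 \subset b.
    by rewrite subUset sub1set xb.
  have := subset_leq_card sx; rewrite cardsU1 xn1 (base_card ax hb h1).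
  by rewrite ltnn.
have yn2 : y \notin b2.
  by apply: contra yb => y2; apply: (subsetP sb); rewrite !inE y1 y2 orbT.
have yE : y \in E by apply: subsetP (sE _ h1) _ y1.
exists y; first by rewrite !inE y1 yn2 yE.
have eb : b = x |: (b1 :\ y).
  apply/eqP; rewrite eqEcard card_exch // (base_card ax hb h1) leqnn andbT.
  apply/subsetP=> z zb; have := subsetP sbx _ zb; rewrite !inE.
  by case/orP=> [->//|->]; rewrite andbT orbC; case: eqP zb yb => // -> ->.
apply/imsetP; exists b => //; rewrite eb; apply/setP=> z; rewrite !inE.
case: (eqVneq z y) => [->|zy] /=.
  by rewrite yE orbF andbT; case: eqP xn1 => // <-; rewrite y1.
by rewrite negb_or andbA.
Qed.

Lemma union_augment (T : finType) (E1 E2 : {set T}) (B1 B2 : {set {set T}}) :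
  base_axiom E1 B1 -> base_axiom E2 B2 ->
  augment [set b1 :|: b2 | b1 in B1, b2 in B2].
Proof.
move=> ax1 ax2; set F := [set _ | _ in _, _ in _].
have down (G : {set {set T}}) (X Y : {set T}) : X \subset Y -> Y \in subfam G -> X \in subfam G.
  move=> s /subfamP[b h sb]; apply/subfamP; exists b => //.
  exact: subset_trans sb.
have split (X : {set T}) : X \in subfam F -> exists X1 X2,
    [/\ X1 \in subfam B1, X2 \in subfam B2, X1 :|: X2 = X & X1 :&: X2 = set0].
  case/subfamP=> _ /imset2P[b1 b2 h1 h2 ->] s.
  exists (X :&: b1), (X :\: b1); split.
  - by apply/subfamP; exists b1; rewrite ?subsetIr.
  - by apply/subfamP; exists b2; rewrite ?subDset.
  - by rewrite setID.
  - by apply/setP=> z; rewrite !inE; case: (z \in b1); rewrite /= ?andbF.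
have join (X1 X2 : {set T}) : X1 \in subfam B1 -> X2 \in subfam B2 -> X1 :|: X2 \in subfam F.
  case/subfamP=> b1 h1 s1 /subfamP[b2 h2 s2]; apply/subfamP.
  by exists (b1 :|: b2); [apply: imset2_f | apply: setUSS].
move=> I J /split[I1 [I2 [i1 i2 eI dI]]] /split[J1 [J2 [j1 j2 eJ dJ]]].
have [n] := ubnP (#|J| - (#|I1 :&: J1| + #|I2 :&: J2|)).
elim: n I1 I2 i1 i2 eI dI => // n IH I1 I2 i1 i2 eI dI ltn lt.
have cI : #|I| = #|I1| + #|I2| by rewrite -eI cardsU dI cards0 subn0.
have cJ : #|J| = #|J1| + #|J2| by rewrite -eJ cardsU dJ cards0 subn0.
have bound (K1 K2 : {set T}) : #|K1 :&: J1| + #|K2 :&: J2| <= #|J|.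
  by rewrite cJ leq_add // subset_leq_card // subsetIr.
have [lt1|lt2] : #|I1| < #|J1| \/ #|I2| < #|J2|.
  case: (ltnP #|I1| #|J1|); first by left.
  move=> le1; right; rewrite ltnNge; apply/negP=> le2.
  by move: lt; rewrite cI cJ ltnNge leq_add.
- have [x] := base_augment ax1 i1 j1 lt1.
  rewrite inE => /andP[xn1 xJ1] ix.
  have xnJ2 : x \notin J2.
    by apply/negP=> xJ2; have := in_set0 x; rewrite -dJ inE xJ1 xJ2.
  have xJ : x \in J by rewrite -eJ inE xJ1.
  case: (boolP (x \in I2)) => [x2|xn2]; last first.
    exists x; first by rewrite inE xJ -eI inE negb_or xn1 xn2.
    by rewrite -eI setUA; apply: join.
  apply: (IH (x |: I1) (I2 :\ x)) => //.
  + by apply: down i2; apply: subD1set.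
  + rewrite -eI; apply/setP=> z; rewrite !inE.
    by case: eqVneq => [->|_] //=; rewrite x2 orbT.
  + apply/setP=> z; rewrite !inE; case: eqVneq => [_|_] //=.
    by have := in_set0 z; rewrite -dI inE.
  have -> : (I2 :\ x) :&: J2 = I2 :&: J2.
    apply/setP=> z; rewrite !inE; case: eqVneq => [->|_] //=.
    by rewrite (negPf xnJ2) andbF.
  have e1 : (x |: I1) :&: J1 = x |: (I1 :&: J1).
    by apply/setP=> z; rewrite !inE; case: eqVneq => [->|_].
  have c1 : #|(x |: I1) :&: J1| = #|I1 :&: J1|.+1.
    by rewrite e1 cardsU1 inE (negPf xn1).
  have := bound (x |: I1) I2; rewrite c1 addSn => bb.
  by rewrite -ltnS; apply: leq_trans ltn; rewrite ltnS ltn_sub2l.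
- have [x] := base_augment ax2 i2 j2 lt2.
  rewrite inE => /andP[xn2 xJ2] ix.
  have xnJ1 : x \notin J1.
    by apply/negP=> xJ1; have := in_set0 x; rewrite -dJ inE xJ1 xJ2.
  have xJ : x \in J by rewrite -eJ inE xJ2 orbT.
  case: (boolP (x \in I1)) => [x1|xn1]; last first.
    exists x; first by rewrite inE xJ -eI inE negb_or xn1 xn2.
    by rewrite -eI setUCA; apply: join.
  apply: (IH (I1 :\ x) (x |: I2)) => //.
  + by apply: down i1; apply: subD1set.
  + rewrite -eI; apply/setP=> z; rewrite !inE.
    by case: eqVneq => [->|_] //=; rewrite x1.
  + apply/setP=> z; rewrite !inE; case: eqVneq => [_|_] //=.
    by have := in_set0 z; rewrite -dI inE.
  have -> : (I1 :\ x) :&: J1 = I1 :&: J1.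
    apply/setP=> z; rewrite !inE; case: eqVneq => [->|_] //=.
    by rewrite (negPf xnJ1) andbF.
  have e1 : (x |: I2) :&: J2 = x |: (I2 :&: J2).
    by apply/setP=> z; rewrite !inE; case: eqVneq => [->|_].
  have c1 : #|(x |: I2) :&: J2| = #|I2 :&: J2|.+1.
    by rewrite e1 cardsU1 inE (negPf xn2).
  have := bound I1 (x |: I2); rewrite c1 addnS => bb.
  by rewrite -ltnS; apply: leq_trans ltn; rewrite ltnS ltn_sub2l.
Qed.

Lemma mfree_axiom (T : finType) (S : {set T}) : base_axiom S [set S].
Proof.
apply/base_axiomP; split.
- by exists S; rewrite inE.
- by move=> b /set1P ->.
- by move=> b1 b2 x /set1P -> /set1P ->; rewrite setDv inE.
Qed.

Lemma mzero_axiom (T : finType) (S : {set T}) : base_axiom S [set set0].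
Proof.
apply/base_axiomP; split.
- by exists set0; rewrite inE.
- by move=> b /set1P ->; apply: sub0set.
- by move=> b1 b2 x /set1P -> /set1P ->; rewrite setDv inE.
Qed.

Lemma msum_axiom (T : finType) (M N : matroid T) :
  [disjoint ground M & ground N] ->
  base_axiom (ground M :|: ground N)
             [set b1 :|: b2 | b1 in bases M, b2 in bases N].
Proof.
case: M N => [E1 B1 ax1] [E2 B2 ax2] /= dE.
have [[b1 h1] s1 ex1] := base_axiomP _ _ ax1.
have [[b2 h2] s2 ex2] := base_axiomP _ _ ax2.
apply/base_axiomP; split.
- by exists (b1 :|: b2); apply: imset2_f.
- by move=> _ /imset2P[c1 c2 g1 g2 ->]; rewrite setUSS ?s1 ?s2.
have nin2 (c d : {set T}) z : c \in B1 -> d \in B2 -> z \in c -> z \notin d.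
  move=> g1 g2 zc; apply/negP=> zd.
  by have := disjointFr dE (subsetP (s1 _ g1) _ zc); rewrite (subsetP (s2 _ g2)).
have nin1 (c d : {set T}) z : c \in B1 -> d \in B2 -> z \in d -> z \notin c.
  by move=> g1 g2; apply: contraL; apply: nin2 g1 g2.
move=> _ _ x /imset2P[c1 c2 g1 g2 ->] /imset2P[d1 d2 k1 k2 ->].
rewrite !inE negb_or => /andP[/andP[xd1 xd2] /orP[xc|xc]].
- have xD : x \in c1 :\: d1 by rewrite inE xd1.
  have [y] := ex1 _ _ _ g1 k1 xD; rewrite inE => /andP[yc yd] hy.
  exists y; first by rewrite !inE negb_or yc yd (nin2 _ _ _ k1 g2 yd).
  apply/imset2P; exists (y |: (c1 :\ x)) c2 => //.
  apply/setP=> z; rewrite !inE; case: (eqVneq z x) => [->|_] //=.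
    by rewrite (negPf (nin2 _ _ _ g1 g2 xc)) !orbF.
  by rewrite orbA.
- have xD : x \in c2 :\: d2 by rewrite inE xd2.
  have [y] := ex2 _ _ _ g2 k2 xD; rewrite inE => /andP[yc yd] hy.
  exists y; first by rewrite !inE negb_or yc yd (nin1 _ _ _ g1 k2 yd) orbT.
  apply/imset2P; exists c1 (y |: (c2 :\ x)) => //.
  apply/setP=> z; rewrite !inE; case: (eqVneq z x) => [->|_] //=.
    by rewrite (negPf (nin1 _ _ _ g1 g2 xc)) !orbF.
  by rewrite orbCA.
Qed.

Lemma mrestr_axiom (T : finType) (M : matroid T) (S : {set T}) :
  base_axiom (ground M :&: S) (maxfam [set I in indep M | I \subset S]).
Proof.
case: M => [E B ax]; rewrite /indep /=.
have [[b0 h0] sE _] := base_axiomP _ _ ax.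
set F := [set _ in _ | _].
have FE (X : {set T}) : (X \in subfam F) = (X \in subfam B) && (X \subset S).
  apply/subfamP/andP=> [[Y]|[XB XS]]; last by exists X => //; rewrite inE XB.
  rewrite inE => /andP[/subfamP[b hb sYb] YS] sXY; split.
    by apply/subfamP; exists b => //; apply: subset_trans sYb.
  exact: subset_trans YS.
apply: maxfam_axiom.
- exists set0; rewrite inE sub0set andbT.
  by apply/subfamP; exists b0; rewrite ?sub0set.
- move=> X; rewrite inE => /andP[/subfamP[b hb sXb] XS].
  by rewrite subsetI XS andbT (subset_trans sXb) ?sE.
- move=> I J; rewrite !FE => /andP[IB IS] /andP[JB JS] lt.
  have [x xD xI] := base_augment ax IB JB lt; exists x => //.
  rewrite FE xI subUset IS sub1set andbT (subsetP JS) //.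
  by move: xD; rewrite inE => /andP[].
Qed.

Lemma munion_axiom (T : finType) (M N : matroid T) :
  base_axiom (ground M :|: ground N)
             (maxfam [set b1 :|: b2 | b1 in bases M, b2 in bases N]).
Proof.
case: M N => [E1 B1 ax1] [E2 B2 ax2] /=.
have [[b1 h1] s1 _] := base_axiomP _ _ ax1.
have [[b2 h2] s2 _] := base_axiomP _ _ ax2.
apply: maxfam_axiom (union_augment ax1 ax2).
- by exists (b1 :|: b2); apply: imset2_f.
- by move=> _ /imset2P[c1 c2 g1 g2 ->]; rewrite setUSS ?s1 ?s2.
Qed.

Lemma minter_axiom (T : finType) (M N : matroid T) :
  base_axiom (ground M :|: ground N)
             (minfam [set b1 :&: b2 | b1 in bases M, b2 in bases N]).
Proof.
case: M N => [E1 B1 ax1] [E2 B2 ax2] /=; set E := E1 :|: E2.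
have up (E' : {set T}) B : E' \subset E -> base_axiom E' B -> base_axiom E B.
  move=> sE' /base_axiomP[? s ?]; apply/base_axiomP; split=> // b /s sb.
  exact: subset_trans sb sE'.
have {}ax1 := up _ _ (subsetUl _ _) ax1; have {}ax2 := up _ _ (subsetUr _ _) ax2.
have [_ s1 _] := base_axiomP _ _ ax1; have [_ s2 _] := base_axiomP _ _ ax2.
pose M1 := Matroid (dual_axiom ax1); pose M2 := Matroid (dual_axiom ax2).
have := dual_axiom (munion_axiom M1 M2); rewrite /= setUid.
set F := [set _ | _ in _, _ in _]; set G := [set _ | _ in _, _ in _].
suff -> : [set E :\: b | b in maxfam F] = minfam G by [].
have FG (X : {set T}) : X \in F -> E :\: X \in G.
  case/imset2P=> _ _ /imsetP[b1 h1 ->] /imsetP[b2 h2 ->] ->.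
  rewrite -setDIr setDDr setDv set0U (setIidPr _) ?imset2_f //.
  exact: subset_trans (subsetIl _ _) (s1 _ h1).
have GF (X : {set T}) : X \in G -> E :\: X \in F.
  case/imset2P=> b1 b2 h1 h2 ->; rewrite setDIr.
  by apply: imset2_f; apply: imset_f.
have FE (X : {set T}) : X \in F -> X \subset E.
  case/imset2P=> _ _ /imsetP[b1 h1 ->] /imsetP[b2 h2 ->] ->.
  by rewrite -setDIr subsetDl.
have GE (X : {set T}) : X \in G -> X \subset E.
  case/imset2P=> b1 b2 h1 h2 ->.
  exact: subset_trans (subsetIl _ _) (s1 _ h1).
have KK (X : {set T}) : X \subset E -> E :\: (E :\: X) = X.
  by move=> s; rewrite setDDr setDv set0U (setIidPr s).
apply/setP=> X; rewrite inE; apply/imsetP/minsetP.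
- case=> b; rewrite inE => /maxsetP[bF mb] ->; split; first exact: FG.
  move=> Y YG sY; rewrite -(mb (E :\: Y)) ?KK ?GF ?GE //.
  by rewrite -(KK b) ?FE // setDS.
- case=> XG mX; exists (E :\: X); last by rewrite KK ?GE.
  rewrite inE; apply/maxsetP; split; first exact: GF.
  move=> Y YF sY; rewrite -(mX (E :\: Y)) ?KK ?FG ?FE //.
  by rewrite -(KK X) ?GE // setDS.
Qed.

Definition mfree (T : finType) (S : {set T}) : matroid T :=
  Matroid (mfree_axiom S).

Definition mzero (T : finType) (S : {set T}) : matroid T :=
  Matroid (mzero_axiom S).

Definition mdual (T : finType) (M : matroid T) : matroid T :=
  Matroid (dual_axiom (matroid_axiom M)).

Definition msum (T : finType) (M N : matroid T)
    (dMN : [disjoint ground M & ground N]) : matroid T :=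
  Matroid (msum_axiom dMN).

(* The independent sets of the restriction are those of M contained in S. *)
Definition mrestr (T : finType) (M : matroid T) (S : {set T}) : matroid T :=
  Matroid (mrestr_axiom M S).

Definition mcontr (T : finType) (M : matroid T) (S : {set T}) : matroid T :=
  mdual (mrestr (mdual M) S).

(* munion and minter are meant for matroids on the same ground set; otherwise
   they only serve as total extensions. *)
Definition munion (T : finType) (M N : matroid T) : matroid T :=
  Matroid (munion_axiom M N).

Definition minter (T : finType) (M N : matroid T) : matroid T :=
  Matroid (minter_axiom M N).

Lemma disjoint_diff (T : finType) (X Y : {set T}) : [disjoint X & Y :\: X].
Proof. by rewrite disjoint_sym -setI_eq0 setIDAC setDIl setDv setI0. Qed.

(* mvee and mwedge are the operations for matroids on S + P and P + Q: with
   S + P = ground M and P + Q = ground N, one has Q = ground N :\: ground M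
   and S = ground M :\: ground N. *)
Definition mvee (T : finType) (M N : matroid T) : matroid T :=
  munion (@msum T M (mzero (ground N :\: ground M)) (disjoint_diff _ _))
         (@msum T N (mzero (ground M :\: ground N)) (disjoint_diff _ _)).

Definition mwedge (T : finType) (M N : matroid T) : matroid T :=
  minter (@msum T M (mfree (ground N :\: ground M)) (disjoint_diff _ _))
         (@msum T N (mfree (ground M :\: ground N)) (disjoint_diff _ _)).

Definition full_sum (T : finType) (B : {set T}) (M N : matroid T) : Prop :=
  munion (mrestr M B) (mrestr N B) = mfree B.

Definition zero_inter (T : finType) (B : {set T}) (M N : matroid T) : Prop :=
  minter (mcontr M B) (mcontr N B) = mzero B.

(* In full_sum, zero_inter and rigid, B stands for the common part
   ground M :&: ground N. *)
Definition rigid (T : finType) (B : {set T}) (M N : matroid T) : Prop :=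
  B = set0 \/ (full_sum B M N /\ zero_inter B M N).

(* Main.v *)
Require Import Defs.
From mathcomp Require Import all_boot.
From Corelib Require Import Setoid.

(** Write [E] and [F] for the ground sets of the two matroids and [B] for the
    common part [E :&: F].  Everything reduces to two existence statements about
    bases: a pair of bases covering [B], and a pair of disjoint bases.

    Padding a matroid by loops does not change its bases, so [mvee] is the plain
    union of matroids (mveeE), whose independent sets are the subsets of unions
    of independent sets.  A matroid is free on [S] exactly when [S] is its ground
    set and is independent (mfreeP); hence each form of the full sum property
    says that [B] lies in a union of two bases (full_sumP, mrestr_mvee_free).

    The zero intersection property is the dual notion.  Complementation exchanges
    minimal intersections and maximal unions, so [mdual] turns [minter] into
    [munion] and [mwedge] into [mvee] (mdual_minter, mdual_mwedge), and it turns
    a matroid consisting of loops into a free one; thus zero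
    intersection for a pair is full sum for the dual pair (zero_inter_dual).
    Finally [B] is covered by the complements [E :\: b], [F :\: c] exactly when
    [b] and [c] are disjoint (cover_mdual).

    Bases that are disjoint exist exactly when the rank of the union is the sum
    of the ranks (rank_mvee_add), because a base of the union is itself a union
    of a base of each matroid.  Applied to the matroids and to their duals this
    gives the rank criterion for rigidity.  It also makes the two existence
    statements hold simultaneously once each of them holds: in that case every
    base of the union is a disjoint union of bases, and [B], being independent
    in the union, is contained in one of them (disjoint_cover). *)

Set Implicit Arguments.
Unset Strict Implicit.
Unset Printing Implicit Defensive.

(** * Matroids in terms of bases and independent sets *)

Section Bases.

Variable T : finType.
Implicit Types (M N : matroid T) (S I J b c : {set T}).

Lemma bases_exists M : exists b, b \in bases M.
Proof. by have [] := base_axiomP _ _ (matroid_axiom M). Qed.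

Lemma bases_sub M b : b \in bases M -> b \subset ground M.
Proof. by have [_ s _] := base_axiomP _ _ (matroid_axiom M); apply: s. Qed.

Lemma rankE M b : b \in bases M -> rank M = #|b|.
Proof.
move=> hb; apply/eqP; rewrite eqn_leq; apply/andP; split; last first.
  exact: (bigmax_sup b).
by apply/bigmax_leqP=> c hc; rewrite (base_card (matroid_axiom M) hc hb).
Qed.

Lemma maxfam_exists (F : {set {set T}}) S :
  S \in F -> exists2 b, b \in maxfam F & S \subset b.
Proof.
move=> SF; have [b bm sb] := @maxset_exists _ (fun X => X \in F) _ SF.
by exists b => //; rewrite inE.
Qed.

Lemma maxfam_mem (F : {set {set T}}) b : b \in maxfam F -> b \in F.
Proof. by rewrite inE; apply: maxsetp. Qed.

Lemma subfam_maxfam (F : {set {set T}}) : subfam (maxfam F) = subfam F.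
Proof.
apply/setP=> S; apply/subfamP/subfamP=> [[b /maxfam_mem hb sb]|[b hb sb]].
  by exists b.
have [c hc sc] := maxfam_exists hb; exists c => //; exact: subset_trans sc.
Qed.

Lemma indep_restr M S I :
  (I \in indep (mrestr M S)) = (I \in indep M) && (I \subset S).
Proof.
rewrite [indep (mrestr M S)](subfam_maxfam [set J in indep M | J \subset S]).
apply/subfamP/andP=> [[J]|[iI sI]].
  rewrite inE => /andP[/subfamP[b hb sJ] sJS] sI; split.
    by apply/subfamP; exists b => //; apply: subset_trans sJ.
  exact: subset_trans sJS.
by exists I => //; rewrite inE iI.
Qed.

Lemma indep_munionP M N S :
  reflect (exists I J, [/\ I \in indep M, J \in indep N & S \subset I :|: J])
          (S \in indep (munion M N)).
Proof.
rewrite /indep /= subfam_maxfam; apply: (iffP (subfamP _ _)).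
  case=> _ /imset2P[b c hb hc ->] s; exists b, c.
  by split=> //; apply/subfamP; [exists b | exists c].
case=> I [J [/subfamP[b hb sI] /subfamP[c hc sJ] s]].
exists (b :|: c); first exact: imset2_f.
by apply: subset_trans s _; apply: setUSS.
Qed.

Lemma indep_munion_basesP M N S :
  reflect (exists b c, [/\ b \in bases M, c \in bases N & S \subset b :|: c])
          (S \in indep (munion M N)).
Proof.
rewrite /indep /= subfam_maxfam; apply: (iffP (subfamP _ _)).
  by case=> _ /imset2P[b c hb hc ->] s; exists b, c.
by case=> b [c [hb hc s]]; exists (b :|: c) => //; apply: imset2_f.
Qed.

Lemma bases_munion M N :
  bases (munion M N) =
  maxfam [set b1 :|: b2 | b1 in bases M, b2 in bases N].
Proof. by []. Qed.

Lemma bases_munionP M N b : b \in bases (munion M N) ->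
  exists b1 b2, [/\ b1 \in bases M, b2 \in bases N & b = b1 :|: b2].
Proof. by move=> /maxfam_mem/imset2P[b1 b2 h1 h2 ->]; exists b1, b2. Qed.

(** All bases have the same cardinality, so a base equal to the ground set is
    the only one. *)
Lemma mfreeP M S : M = mfree S <-> ground M = S /\ S \in indep M.
Proof.
split=> [->|[gM /subfamP[b hb sb]]].
  by split=> //; apply/subfamP; exists S => //=; rewrite inE.
have eS c : c \in bases M -> c = S.
  move=> hc; apply/eqP; rewrite eqEcard -{1}gM bases_sub //=.
  by rewrite (base_card (matroid_axiom M) hc hb) subset_leq_card.
apply: matroid_eq => //=; apply/setP=> c; rewrite inE.
by apply/idP/eqP=> [/eS //|->]; rewrite -(eS b hb).
Qed.

Lemma mrestr_free M S :
  S \subset ground M -> mrestr M S = mfree S <-> S \in indep M.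
Proof.
move=> sS; rewrite mfreeP indep_restr subxx andbT /= (setIidPr sS).
by split=> [[]|].
Qed.

End Bases.

(** * Duality *)

Section Duality.

Variable T : finType.
Implicit Types (M N : matroid T) (E S b c : {set T}).

Lemma setDDK E S : S \subset E -> E :\: (E :\: S) = S.
Proof. by move=> s; rewrite setDDr setDv set0U (setIidPr s). Qed.

Lemma bases_mdual M b : b \in bases M -> ground M :\: b \in bases (mdual M).
Proof. exact: imset_f. Qed.

Lemma mdualK M : mdual (mdual M) = M.
Proof.
apply: matroid_eq => //=; apply/setP=> b; apply/imsetP/idP.
  by case=> _ /imsetP[c hc ->] ->; rewrite setDDK ?bases_sub.
move=> hb; exists (ground M :\: b); first exact: bases_mdual.
by rewrite setDDK ?bases_sub.
Qed.

Lemma mdual_mzero S : mdual (mzero S) = mfree S.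
Proof. by apply: matroid_eq => //=; rewrite imset_set1 setD0. Qed.

Lemma mdual_mfree S : mdual (mfree S) = mzero S.
Proof. by rewrite -mdual_mzero mdualK. Qed.

Lemma mzero_mdual M S : M = mzero S <-> mdual M = mfree S.
Proof.
split=> [->|e]; first exact: mdual_mzero.
by rewrite -(mdualK M) e mdual_mfree.
Qed.

Lemma mdual_minfam E (G : {set {set T}}) : (forall X, X \in G -> X \subset E) ->
  [set E :\: b | b in minfam G] = maxfam [set E :\: b | b in G].
Proof.
move=> sG; apply/setP=> X; rewrite [RHS]inE; apply/imsetP/maxsetP.
  case=> b; rewrite inE => /minsetP[bG mb] ->; split; first exact: imset_f.
  move=> _ /imsetP[c cG ->] s; rewrite (mb c) //.
  by rewrite -(setDDK (sG _ bG)) -(setDDK (sG _ cG)) setDS.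
case=> /imsetP[b bG ->] mb; exists b => //; rewrite inE.
apply/minsetP; split=> // c cG s.
by rewrite -(setDDK (sG _ bG)) -(mb (E :\: c)) ?imset_f ?setDS // setDDK ?sG.
Qed.

(** De Morgan: intersections of bases are the complements of unions of dual
    bases.  Both matroids must be complemented in the same set. *)
Lemma mdual_minter M N : ground M = ground N ->
  mdual (minter M N) = munion (mdual M) (mdual N).
Proof.
move=> e; apply: matroid_eq => //=; rewrite -e setUid mdual_minfam; last first.
  move=> _ /imset2P[b c hb _ ->].
  by apply: subset_trans (bases_sub hb); apply: subsetIl.
congr maxfam; apply/setP=> X; apply/imsetP/imset2P.
  case=> _ /imset2P[b c hb hc ->] ->.
  by exists (ground M :\: b) (ground M :\: c); rewrite ?imset_f ?setDIr.
case=> _ _ /imsetP[b hb ->] /imsetP[c hc ->] ->.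
by exists (b :&: c); rewrite ?imset2_f ?setDIr.
Qed.

Lemma mdual_msum M N (d : [disjoint ground M & ground N])
    (d' : [disjoint ground (mdual M) & ground (mdual N)]) :
  mdual (msum d) = msum d'.
Proof.
have split b c : b \in bases M -> c \in bases N ->
    (ground M :|: ground N) :\: (b :|: c)
    = (ground M :\: b) :|: (ground N :\: c).
  move=> /bases_sub sb /bases_sub sc; apply/setP=> z; rewrite !inE.
  case zM: (z \in ground M) => /=.
    have zN := disjointFr d zM; rewrite zN andbF orbF.
    by rewrite (contraFF (subsetP sc z) zN) orbF.
  by rewrite (contraFF (subsetP sb z) zM) andbF.
apply: matroid_eq => //=; apply/setP=> X; apply/imsetP/imset2P.
  case=> _ /imset2P[b c hb hc ->] ->.
  by exists (ground M :\: b) (ground N :\: c); rewrite ?imset_f ?split.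
case=> _ _ /imsetP[b hb ->] /imsetP[c hc ->] ->.
by exists (b :|: c); rewrite ?imset2_f ?split.
Qed.

Lemma bases_msum_mzero M S (d : [disjoint ground M & ground (mzero S)]) :
  bases (msum d) = bases M.
Proof.
apply/setP=> X; apply/imset2P/idP=> [[b _ hb /set1P-> ->]|hX].
  by rewrite setU0.
by exists X set0; rewrite ?inE ?setU0.
Qed.

Lemma mveeE M N : mvee M N = munion M N.
Proof.
apply: matroid_eq; last by rewrite !bases_munion !bases_msum_mzero.
by apply/setP=> z /=; rewrite !inE; case: (z \in ground M); case: (z \in ground N).
Qed.

(** Coloops are dual to loops, so the coloops padding both matroids in [mwedge]
    become the loops padding them in [mvee]. *)
Lemma mdual_mwedge M N : mdual (mwedge M N) = mvee (mdual M) (mdual N).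
Proof.
rewrite /mwedge mdual_minter /=; last first.
  by apply/setP=> z; rewrite !inE; case: (z \in ground M); case: (z \in ground N).
have dual_free M' S (d : [disjoint ground M' & ground (mfree S)])
    (d' : [disjoint ground (mdual M') & ground (mzero S)]) :
    mdual (msum d) = msum d'.
  have d2 : [disjoint ground (mdual M') & ground (mdual (mfree S))] by [].
  rewrite (mdual_msum d d2).
  by apply: matroid_eq => //=; rewrite imset_set1 setDv.
rewrite /mvee; congr munion; exact: dual_free.
Qed.

Lemma mcontr_mzero M S : mcontr M S = mzero S <-> mrestr (mdual M) S = mfree S.
Proof. by rewrite mzero_mdual mdualK. Qed.

End Duality.

(** * Full sum, zero intersection and rank *)

Section Pairs.

Variable T : finType.
Implicit Types (M N : matroid T) (S b c : {set T}).

Lemma mrestr_mvee_free M N S : S \subset ground M ->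
  mrestr (mvee M N) S = mfree S <->
  exists b c, [/\ b \in bases M, c \in bases N & S \subset b :|: c].
Proof.
move=> sS; rewrite mveeE mrestr_free; first by split=> /indep_munion_basesP.
exact: subset_trans sS (subsetUl _ _).
Qed.

(** Cutting two bases that cover [S] down to [S] leaves independent sets of the
    restrictions which still cover [S]. *)
Lemma full_sumP M N S : S \subset ground M ->
  full_sum S M N <->
  exists b c, [/\ b \in bases M, c \in bases N & S \subset b :|: c].
Proof.
move=> sS; rewrite /full_sum mfreeP; split.
  case=> _ /indep_munionP[I [J []]]; rewrite !indep_restr.
  move=> /andP[/subfamP[b hb sI] _] /andP[/subfamP[c hc sJ] _] s.
  by exists b, c; split=> //; apply: subset_trans s _; apply: setUSS.
case=> b [c [hb hc s]]; split.
  by rewrite /= (setIidPr sS) (setUidPl _) ?subsetIr.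
apply/indep_munionP; exists (b :&: S), (c :&: S); rewrite !indep_restr !subsetIr.
rewrite !andbT -setIUl subsetI s subxx; split=> //.
  by apply/subfamP; exists b; rewrite ?subsetIl.
by apply/subfamP; exists c; rewrite ?subsetIl.
Qed.

Lemma zero_inter_dual M N S : S \subset ground M -> S \subset ground N ->
  zero_inter S M N <-> full_sum S (mdual M) (mdual N).
Proof.
move=> sM sN; rewrite /zero_inter mzero_mdual mdual_minter ?mdualK //=.
by rewrite (setIidPr sM) (setIidPr sN).
Qed.

(** The elements of the common part missed by both complements are those of
    [b :&: c]. *)
Lemma cover_mdual M N b c : b \in bases M -> c \in bases N ->
  (ground M :&: ground N \subset (ground M :\: b) :|: (ground N :\: c))
  = (b :&: c == set0).
Proof.
move=> /bases_sub/subsetP sb /bases_sub/subsetP sc.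
apply/subsetP/eqP=> [cov|d0 z].
  apply/setP=> z; rewrite !inE; apply/andP=> -[zb zc].
  by have := cov z; rewrite !inE zb zc sb // sc // => /(_ isT).
rewrite !inE => /andP[-> ->]; rewrite !andbT -negb_and.
by have := in_set0 z; rewrite -d0 inE => ->.
Qed.

Lemma cover_mdualP M N :
  (exists b c, [/\ b \in bases (mdual M), c \in bases (mdual N) &
                   ground M :&: ground N \subset b :|: c]) <->
  exists b c, [/\ b \in bases M, c \in bases N & b :&: c = set0].
Proof.
split=> [[_ [_ [/imsetP[b hb ->] /imsetP[c hc ->]]]]|[b [c [hb hc d0]]]].
  by rewrite cover_mdual // => /eqP d0; exists b, c.
exists (ground M :\: b), (ground N :\: c).
by rewrite !bases_mdual // cover_mdual // d0.
Qed.

Lemma zero_interP M N :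
  zero_inter (ground M :&: ground N) M N <->
  exists b c, [/\ b \in bases M, c \in bases N & b :&: c = set0].
Proof.
rewrite zero_inter_dual ?subsetIl ?subsetIr // -cover_mdualP.
by apply: full_sumP; apply: subsetIl.
Qed.

Lemma mcontr_mwedge_zero M N :
  mcontr (mwedge M N) (ground M :&: ground N) = mzero (ground M :&: ground N) <->
  exists b c, [/\ b \in bases M, c \in bases N & b :&: c = set0].
Proof.
rewrite mcontr_mzero mdual_mwedge -cover_mdualP.
by apply: mrestr_mvee_free; apply: subsetIl.
Qed.

Lemma rank_add_disjoint M N b c : b \in bases M -> c \in bases N ->
  (rank M + rank N <= #|b :|: c|) = (b :&: c == set0).
Proof.
move=> hb hc; rewrite (rankE hb) (rankE hc) cardsU -cards_eq0.
have le : #|b :&: c| <= #|b| + #|c|.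
  by apply: leq_trans (leq_addr _ _); rewrite subset_leq_card ?subsetIl.
by rewrite leq_subRL // -{2}[#|b| + #|c|]add0n leq_add2r leqn0.
Qed.

Lemma rank_munion_le M N : rank (munion M N) <= rank M + rank N.
Proof.
have [X hX] := bases_exists (munion M N).
have [b [c [hb hc e]]] := bases_munionP hX.
by rewrite (rankE hX) (rankE hb) (rankE hc) e leq_card_setU.
Qed.

(** A base of the union is [b :|: c] for bases [b] and [c], so its size reaches
    the sum of the ranks only if they do not meet; conversely a disjoint pair
    gives an independent set of that size. *)
Lemma rank_mvee_add M N :
  rank (mvee M N) = rank M + rank N <->
  exists b c, [/\ b \in bases M, c \in bases N & b :&: c = set0].
Proof.
rewrite mveeE; split=> [rk|[b [c [hb hc d0]]]].
  have [X hX] := bases_exists (munion M N).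
  have [b [c [hb hc e]]] := bases_munionP hX.
  exists b, c; split=> //; apply/eqP.
  by rewrite -(rank_add_disjoint hb hc) -rk (rankE hX) e.
apply/eqP; rewrite eqn_leq rank_munion_le /=.
have /subfamP[X hX sX] : b :|: c \in indep (munion M N).
  by apply/indep_munion_basesP; exists b, c.
rewrite (rankE hX); apply: leq_trans (subset_leq_card sX).
by rewrite rank_add_disjoint // d0.
Qed.

(** If some pair of bases is disjoint, the rank of the union forces every base
    of the union to split into disjoint bases; take one containing [S]. *)
Lemma disjoint_cover M N S :
  (exists b c, [/\ b \in bases M, c \in bases N & S \subset b :|: c]) ->
  (exists b c, [/\ b \in bases M, c \in bases N & b :&: c = set0]) ->
  exists b c, [/\ b \in bases M, c \in bases N, b :&: c = set0 & S \subset b :|: c].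
Proof.
move=> /indep_munion_basesP/subfamP[X hX sX] /rank_mvee_add; rewrite mveeE => rk.
have [b [c [hb hc e]]] := bases_munionP hX.
exists b, c; rewrite -e; split=> //; apply/eqP.
by rewrite -(rank_add_disjoint hb hc) -rk (rankE hX) e.
Qed.

(** The convention that a pair with empty common part is rigid is consistent:
    both properties then hold, since subsets of disjoint sets are disjoint. *)
Lemma rigidE M N (B := ground M :&: ground N) :
  rigid B M N <-> full_sum B M N /\ zero_inter B M N.
Proof.
split=> [[B0|//]|]; last by right.
have [[b hb] [c hc]] := (bases_exists M, bases_exists N).
split; first by apply/full_sumP; [apply: subsetIl | exists b, c; rewrite B0 sub0set].
apply/zero_interP; exists b, c; split=> //; apply/eqP.
by rewrite -subset0 -B0; apply: setISS; apply: bases_sub.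
Qed.

End Pairs.

Theorem theorem53 (T : finType) (A B C : {set T})
    (disjAB : [disjoint A & B]) (disjBC : [disjoint B & C])
    (disjAC : [disjoint A & C])
    (MAB MBC : matroid T)
    (groundAB : ground MAB = A :|: B) (groundBC : ground MBC = B :|: C) :
  (* 1 *)
  [/\ (full_sum B MAB MBC <-> mrestr (mvee MAB MBC) B = mfree B)
      /\ (full_sum B MAB MBC <->
          exists bAB bBC : {set T},
            [/\ bAB \in bases MAB, bBC \in bases MBC & B \subset bAB :|: bBC]),
  (* 2 *)
      (zero_inter B MAB MBC <-> mcontr (mwedge MAB MBC) B = mzero B)
      /\ (zero_inter B MAB MBC <->
          exists bAB bBC : {set T},
            [/\ bAB \in bases MAB, bBC \in bases MBC & bAB :&: bBC = set0]),
  (* 3 *)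
      rigid B MAB MBC <->
        rank (mvee MAB MBC) = rank MAB + rank MBC
        /\ rank (mvee (mdual MAB) (mdual MBC))
             = rank (mdual MAB) + rank (mdual MBC),
  (* 4 *)
      [/\ zero_inter B MAB MBC <-> full_sum B (mdual MAB) (mdual MBC),
          full_sum B MAB MBC <-> zero_inter B (mdual MAB) (mdual MBC)
        & rigid B MAB MBC <-> rigid B (mdual MAB) (mdual MBC)]
  (* 5 *)
    & rigid B MAB MBC <->
        exists bAB bBC : {set T},
          [/\ bAB \in bases MAB, bBC \in bases MBC,
              bAB :&: bBC = set0 & B \subset bAB :|: bBC]].
Proof.
have eB : B = ground MAB :&: ground MBC.
  rewrite groundAB groundBC setUC -setUIr.
  by rewrite (disjoint_setI0 disjAC) setU0.
have sB : B \subset ground MAB by rewrite eB subsetIl.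
have sB' : B \subset ground MBC by rewrite eB subsetIr.
have fsP := full_sumP MBC sB.
have ziP := zero_interP MAB MBC; rewrite -eB in ziP.
have zi4 := zero_inter_dual sB sB'.
have fs4 : full_sum B MAB MBC <-> zero_inter B (mdual MAB) (mdual MBC).
  by rewrite zero_inter_dual // !mdualK.
have rigP := rigidE MAB MBC; rewrite -eB in rigP.
have rigP' := rigidE (mdual MAB) (mdual MBC); rewrite -eB in rigP'.
split.
- by rewrite fsP mrestr_mvee_free.
- by rewrite ziP; have := mcontr_mwedge_zero MAB MBC; rewrite -eB => ->.
- rewrite rigP ziP fs4 !rank_mvee_add.
  by have := zero_interP (mdual MAB) (mdual MBC); rewrite -eB => ->; split=> -[].
- split=> //; rewrite rigP rigP' -zi4 -fs4.
  by split=> -[].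
- rewrite rigP fsP ziP; split=> [[cov dis]|[b [c [hb hc d0 s]]]].
    exact: disjoint_cover.
  by split; exists b, c.
Qed.
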